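(* Let $B\in\mathbb{B}(\mathscr{H})$, and let $P,Q\in\mathbb{B}(\mathscr{H})$ be orthogonal projections such that $\mathscr{R}(P)\subseteq\overline{\mathscr{R}(B)}$ and $\mathscr{R}(Q)\subseteq\overline{\mathscr{R}(B^* )}$. Then $PBQ\stackrel{*}{\leq}B$ if and only if $PBQB^*=BQB^*P$ and $QB^*PB=B^*PBQ$.
   Context: $\mathscr{H}$ is a complex Hilbert space, $\mathbb{B}(\mathscr{H})$ is the space of bounded linear operators on $\mathscr{H}$, and $\mathscr{R}(\cdot)$ denotes the range. For $C,D\in\mathbb{B}(\mathscr{H})$, the $*$-order $C\stackrel{*}{\leq}D$ means $CC^*=DC^*$ and $C^*C=C^*D$. *)

(* Defs.v *)
From HB Require Import structures.
From mathcomp Require Import all_boot all_order all_algebra sesquilinear.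
From mathcomp Require Import complex.
From mathcomp Require Import all_classical all_reals all_analysis.

Set Implicit Arguments.
Unset Strict Implicit.
Unset Printing Implicit Defensive.

Import Order.TTheory GRing.Theory Num.Theory numFieldNormedType.Exports.
Local Open Scope classical_set_scope.
Local Open Scope ring_scope.
Local Open Scope complex_scope.

(* A complex Hilbert space is a Banach space over R[i] whose norm comes from an
   inner product, linear in its first argument and conjugate-linear in its
   second one. Norms take their (real) values in R[i]. *)
HB.mixin Record isHilbert (R : realType) H of CompleteNormedModule R[i] H := {
  hdot : {dot H for @Num.conj R[i]};
  hdot_norm : forall x : H, `|x| ^+ 2 = hdot x x
}.

#[short(type="hilbertType")]
HB.structure Definition Hilbert (R : realType) :=
  {H of isHilbert R H & CompleteNormedModule R[i] H}.

Declare Scope bop_scope.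
Delimit Scope bop_scope with Bop.

Section BoundedOperators.
Variables (R : realType) (H : hilbertType R).

(* For a linear map, boundedness near 0 is boundedness in the operator norm
   (linear_boundedP) and is equivalent to continuity
   (linear_bounded_continuous). *)
Record bop := Bop {
  bop_linear :> {linear H -> H};
  bop_bounded : bounded_near bop_linear (nbhs (0 : H))
}.

Lemma bopP (A B : bop) : A = B <-> A =1 B.
Proof.
split=> [->//|]; case: A B => [[f [[fD] [fZ]]] Bf] [[g [[gD] [gZ]]] Bg] /=.
move=> /funext fg; subst g.
rewrite (Prop_irrelevance gD fD) (Prop_irrelevance gZ fZ) in Bg *.
by rewrite (Prop_irrelevance Bg Bf).
Qed.

Lemma comp_bounded (A B : bop) :
  bounded_near (A \o B : {linear H -> H}) (nbhs (0 : H)).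
Proof.
apply/linear_bounded_continuous => x.
by apply: continuous_comp; apply: (iffLR (linear_bounded_continuous _));
  exact: bop_bounded.
Qed.

Definition bop_comp (A B : bop) : bop := Bop (comp_bounded A B).

HB.instance Definition _ := gen_eqMixin bop.
HB.instance Definition _ := gen_choiceMixin bop.

(* By the Riesz representation theorem exactly one bounded operator satisfies
   the adjunction identity, so the default value of xget is never used. *)
Definition adjoint (A : bop) : bop :=
  xget A [set A' : bop | forall x y : H, hdot (A x) y = hdot x (A' y)].

End BoundedOperators.

Arguments bop {R} H.
Bind Scope bop_scope with bop.

Notation "A * B" := (bop_comp A B) : bop_scope.
Notation "A ^*" := (adjoint A) : bop_scope.

Definition orthogonal_projection (R : realType) (H : hilbertType R)
  (P : bop H) : Prop := (P * P = P)%Bop /\ (P^* = P)%Bop.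

Definition star_le (R : realType) (H : hilbertType R) (C D : bop H) : Prop :=
  (C * C^* = D * C^*)%Bop /\ (C^* * C = C^* * D)%Bop.

Notation "C '<=*' D" := (star_le C D) (at level 70, no associativity) : bop_scope.

(* Main.v *)
From HB Require Import structures.
Require Import Defs.
From mathcomp Require Import all_boot all_order all_algebra.
From mathcomp Require Import sesquilinear complex lra.
From mathcomp Require Import all_classical all_reals all_analysis.
Local Open Scope classical_set_scope.

Set Implicit Arguments.
Unset Strict Implicit.
Unset Printing Implicit Defensive.

Import Order.TTheory GRing.Theory Num.Theory numFieldNormedType.Exports.
Local Open Scope ring_scope.
Local Open Scope complex_scope.

(** Put C = P B Q, so that C^* = Q B^* P. Since P and Q are idempotent,
    C <=* B amounts to the two equations
      P B Q B^* P = B Q B^* P   and   Q B^* P B Q = Q B^* P B.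
    The left-hand sides are self-adjoint, hence so are the right-hand sides,
    and taking adjoints of these gives P B Q B^* = B Q B^* P and
    Q B^* P B = B^* P B Q. Conversely, multiply the first commutation relation
    by P on the right and the second one by Q on the left.

    This is pure algebra in the * -monoid of bounded operators, so the work lies
    in showing that the adjoint is a genuine involution: [hdot_adjoint],
    [adjointK], [adjoint_comp]. Existence of adjoints comes from the Riesz
    representation theorem ([riesz_representation]): a nonzero bounded
    functional phi takes the value 1 on a closed hyperplane, this hyperplane has
    an element z of minimal norm ([min_norm_exists], by the parallelogram law
    and completeness), minimality makes z orthogonal to the kernel of phi
    ([min_norm_orthogonal]), and so phi is the inner product with a multiple
    of z. *)

Section HilbertSpace.
Context {R : realType} {H : hilbertType R}.
Implicit Types (x y z v : H).

(** * Norm and inner product *)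

(** Norms in H are elements of R[i]; infima and order arithmetic need them in
    the real field R. *)
Definition rnorm x : R := complex.Re `|x|.

Lemma normE x : `|x| = (rnorm x)%:C.
Proof. by rewrite /rnorm RRe_real// ger0_real. Qed.

Lemma rnorm_ge0 x : 0 <= rnorm x.
Proof. by rewrite -ler0c -normE. Qed.

Lemma ler_rnormD x y : rnorm (x + y) <= rnorm x + rnorm y.
Proof. by rewrite -lecR rmorphD /= -!normE ler_normD. Qed.

Lemma rnorm_parallelogram x y :
  rnorm (x + y) ^+ 2 + rnorm (x - y) ^+ 2
  = (rnorm x ^+ 2 + rnorm y ^+ 2) *+ 2.
Proof.
apply: (@complexI R); rewrite rmorphMn !rmorphD !rmorphXn /= -!normE.
by rewrite !hdot_norm hnormD hnormB addrACA subrr addr0 mulr2n.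
Qed.

Lemma hdotC x y : hdot x y = ((hdot y x)^*)%R.
Proof. by rewrite hermC /= expr0 mul1r. Qed.

Lemma hdotZr a x y : hdot x (a *: y) = (a^*)%R * hdot x y.
Proof. exact: linearZr_LR. Qed.

Lemma hdot_eq0 x : hdot x x = 0 -> x = 0.
Proof. by rewrite -hdot_norm => /eqP; rewrite sqrf_eq0 normr_eq0 => /eqP. Qed.

Lemma hdot_injr y z : (forall x, hdot x y = hdot x z) -> y = z.
Proof.
move=> eqyz; apply/eqP; rewrite -subr_eq0; apply/eqP/hdot_eq0.
by rewrite linearBr /= eqyz subrr.
Qed.

Lemma hdot_proj_res x v : v != 0 -> hdot (x - (hdot x v / hdot v v) *: v) v = 0.
Proof.
move=> v0; rewrite linearBl linearZl_LR /= divfK ?subrr//.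
by apply: contra_neq v0; exact: hdot_eq0.
Qed.

(** Pythagoras for the orthogonal decomposition of x along the line of v. *)
Lemma hdot_proj_norm x v (t := hdot x v / hdot v v) : v != 0 ->
  `|x| ^+ 2 = `|x - t *: v| ^+ 2 + (`|t| * `|v|) ^+ 2.
Proof.
move=> v0; rewrite -normrZ !hdot_norm -hnormDd ?subrK//.
by rewrite linearZr_LR /= hdot_proj_res ?mulr0.
Qed.

(** The projection of x on the line of y is no longer than x itself. *)
Lemma cauchy_schwarz x y : `|hdot x y| <= `|x| * `|y|.
Proof.
have [->|y0] := eqVneq y 0; first by rewrite linear0r !normr0 mulr0.
have xy : `|hdot x y| = (`|hdot x y / hdot y y| * `|y|) * `|y|.
  by rewrite -mulrA -expr2 hdot_norm normrM normfV -hdot_norm normrX normr_id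
     divfK// sqrf_eq0 normr_eq0.
rewrite xy ler_wpM2r// -ler_sqr ?nnegrE ?mulr_ge0// (hdot_proj_norm x y0).
by rewrite lerDr exprn_ge0.
Qed.

(** By Pythagoras, subtracting from z its projection on the line of v strictly
    shortens z unless this projection vanishes. *)
Lemma min_norm_orthogonal z v :
  (forall t, `|z| <= `|z - t *: v|) -> hdot z v = 0.
Proof.
have [->|v0] := eqVneq v 0; first by rewrite linear0r.
set t := hdot z v / hdot v v => /(_ t).
rewrite -ler_sqr ?nnegrE// {1}(hdot_proj_norm z v0) -/t gerDl.
move=> tv_le0; have : (`|t| * `|v|) ^+ 2 == 0.
  by rewrite eq_le tv_le0 exprn_ge0 ?mulr_ge0.
rewrite sqrf_eq0 mulf_eq0 !normr_eq0 (negPf v0) orbF mulf_eq0 invr_eq0.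
case/orP => /eqP; first by [].
by move=> /hdot_eq0 v00; rewrite v00 eqxx in v0.
Qed.

(** * The Riesz representation theorem *)

(** Let d be the infimum of the norms on the hyperplane phi = 1. Midpoints stay
    in the hyperplane, so the parallelogram law makes two elements whose norms
    are close to d close to each other. The sets of near-minimal elements thus
    generate a Cauchy filter, whose limit is the minimizer. *)
Lemma min_norm_exists (phi : {scalar H}) (M : R[i]) x0 :
  (forall x, `|phi x| <= M * `|x|) -> phi x0 = 1 ->
  exists2 z, phi z = 1 & forall x, phi x = 1 -> `|z| <= `|x|.
Proof.
move=> phiM phix0.
pose S := [set x | phi x = 1]; pose d := inf (rnorm @` S).
have infS : has_inf (rnorm @` S).
  by split; [exists (rnorm x0), x0 | exists 0 => _ [x _ <-]; exact: rnorm_ge0].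
have d_le x : phi x = 1 -> d <= rnorm x.
  by move=> Sx; apply: ge_inf; [case: infS | exists x].
have d0 : 0 <= d.
  by apply: lb_le_inf; [case: infS | move=> _ [x _ <-]; exact: rnorm_ge0].
have near_min e x y : 0 < e -> phi x = 1 -> phi y = 1 ->
    rnorm x < d + e -> rnorm y < d + e ->
    rnorm (x - y) ^+ 2 <= 4 * e * (2 * d + e).
  move=> e0 Sx Sy xe ye; have := rnorm_parallelogram x y.
  have : d <= rnorm (2^-1 *: (x + y)).
    by apply: d_le; rewrite linearZ linearD /= Sx Sy mulVf// pnatr_eq0.
  have -> : rnorm (2^-1 *: (x + y)) = rnorm (x + y) / 2.
    apply: (@complexI R); rewrite -normE normrZ normE rmorphM /= fmorphV mulrC.
    by rewrite rmorph_nat normfV normr_nat.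
  have := rnorm_ge0 x; have := rnorm_ge0 y; nra.
pose A (e : R) := [set x | phi x = 1 /\ rnorm x < d + e].
pose F := filter_from [set e : R | 0 < e] A.
have A0 e : 0 < e -> A e !=set0.
  by move=> e0; have [_ [x Sx <-] xd] := inf_adherent e0 infS; exists x.
have FF : ProperFilter F.
  apply: filter_from_proper => //; apply: filter_from_filter; last first.
    move=> e e' e0 e'0; exists (Num.min e e'); first by rewrite /= lt_min e0.
    by move=> x [Sx]; rewrite addr_minr lt_min => /andP[xe xe']; do 2!split.
  by exists 1; exact: ltr01.
have ballE x y (e : R) : rnorm (x - y) < e -> ball x e%:C y.
  by move=> xye; rewrite -ball_normE /ball_ /= normE ltcR.
have /cauchy_cvg Fcvg : cauchy F.
  apply: cauchy_exP => eps eps0.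
  have [e e0 ->] : exists2 e : R, 0 < e & eps = e%:C.
    exists (complex.Re eps); last by rewrite RRe_real// gtr0_real.
    by rewrite -ltcR RRe_real// gtr0_real.
  (* With m = min 1 c, the bound 4 m (2 d + m) of near_min is at most
     4 c (2 d + 1), hence smaller than e ^ 2. *)
  pose c := e ^+ 2 / (8 * (d + 1)).
  have cE : c * (8 * (d + 1)) = e ^+ 2.
    by rewrite divfK// mulf_neq0 ?pnatr_eq0// gt_eqF// ltr_wpDl.
  have c0 : 0 < c by rewrite divr_gt0 ?exprn_gt0// mulr_gt0// ltr_wpDl.
  have m0 : 0 < Num.min 1 c by rewrite lt_min ltr01.
  have [x Ax] := A0 _ m0; exists x; exists (Num.min 1 c) => // y Ay.
  apply: ballE; rewrite -ltr_sqr ?nnegrE ?rnorm_ge0 ?ltW//.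
  apply: (le_lt_trans (near_min _ _ _ m0 Ax.1 Ay.1 Ax.2 Ay.2)).
  have : Num.min 1 c <= 1 by rewrite ge_min lexx.
  have : Num.min 1 c <= c by rewrite ge_min lexx orbT.
  rewrite -cE; move: (Num.min 1 c) m0 => m; nra.
pose z := lim F.
have approx (e : R) : 0 < e -> exists2 x, A e x & rnorm (z - x) < e.
  move=> e0; have [|e' e'0 sub] := Fcvg (ball z e%:C).
    by apply: nbhsx_ballx; rewrite ltcR.
  have m0 : 0 < Num.min e e' by rewrite lt_min e0.
  have [x [Sx]] := A0 _ m0; rewrite addr_minr lt_min => /andP[xe xe'].
  exists x => //; have := sub x (conj Sx xe').
  by rewrite -ball_normE /ball_ /= normE ltcR.
exists z.
  (* M is only known as a complex number; the bound at x0 forces it to be a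
     positive real. *)
  have M0 : 0 < M.
    have := phiM x0; rewrite phix0 normr1 => /(lt_le_trans ltr01).
    have [->|x00] := eqVneq x0 0; first by rewrite normr0 mulr0 ltxx.
    by rewrite pmulr_lgt0// normr_gt0.
  have [m m0 ME] : exists2 m : R, 0 < m & M = m%:C.
    exists (complex.Re M); last by rewrite RRe_real// gtr0_real.
    by rewrite -ltcR RRe_real// gtr0_real.
  apply/eqP; rewrite -subr_eq0 -normr_le0 normc_def lecR.
  apply/ler_addgt0Pr => e e0; have [|x [Sx _] zx] := approx (e / m).
    by rewrite divr_gt0.
  rewrite add0r -lecR -normc_def -Sx -linearB; apply: (le_trans (phiM _)).
  by rewrite ME normE -rmorphM lecR mulrC -ler_pdivlMr// ltW.
move=> x Sx; rewrite !normE lecR; apply: (@le_trans _ _ d); last exact: d_le.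
apply/ler_addgt0Pr => e e0; have [|y [Sy yd] zy] := approx (e / 2).
  by rewrite divr_gt0.
have := ler_rnormD (z - y) y; rewrite subrK; lra.
Qed.

(** The element z of minimal norm with phi z = 1 is orthogonal to the kernel of
    phi, and every x - phi x *: z lies in this kernel; hence
    hdot x z = phi x * hdot z z. *)
Lemma riesz_representation (phi : {scalar H}) (M : R[i]) :
  (forall x, `|phi x| <= M * `|x|) -> exists z, forall x, phi x = hdot x z.
Proof.
move=> phiM.
have [phi0|/existsNP[x0 /eqP phix0]] := pselect (forall x, phi x = 0).
  by exists 0 => x; rewrite linear0r phi0.
have [|z phiz zmin] := min_norm_exists phiM (x0 := (phi x0)^-1 *: x0).
  by rewrite linearZ /= mulVf.
have zker v : phi v = 0 -> hdot z v = 0.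
  move=> phiv; apply: min_norm_orthogonal => t; apply: zmin.
  by rewrite linearB linearZ /= phiv mulr0 subr0.
have z0 : hdot z z != 0.
  apply: contra_eq_neq phiz => /hdot_eq0 ->.
  by rewrite linear0 eq_sym oner_eq0.
exists (((hdot z z)^-1)^*%R *: z) => x.
have : hdot (x - phi x *: z) z = 0.
  by rewrite hdotC zker ?rmorph0// linearB linearZ /= phiz mulr1 subrr.
rewrite linearBl linearZl_LR /= => /eqP; rewrite subr_eq0 => /eqP xz.
by rewrite hdotZr conjCK xz mulrC mulfK.
Qed.

(** * Adjoints *)

Lemma bop_bound (A : bop H) :
  exists2 M : R[i], 0 <= M & forall x, `|A x| <= M * `|x|.
Proof.
have /linear_boundedP /pinfty_ex_gt0 [M M0 AM] := bop_bounded A.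
by exists M; [exact: ltW|].
Qed.

(** Riesz represents each functional x |-> hdot (A x) y by a vector f y; f is
    linear because representing vectors are unique, and it inherits the bound M
    of A, as |f y|^2 = hdot (A (f y)) y <= M |f y| |y|. *)
Lemma adjoint_exists (A : bop H) :
  exists A' : bop H, forall x y, hdot (A x) y = hdot x (A' y).
Proof.
have [M M0 AM] := bop_bound A.
have Arep y : exists z, forall x, hdot (A x) y = hdot x z.
  pose phi x := hdot (A x) y.
  have phi_lin : scalar phi.
    by move=> a u v; rewrite /phi linearP linearDl linearZl_LR.
  pose phiL : {scalar H} :=
    HB.pack phi (GRing.isLinear.Build R[i] H R[i] *%R phi phi_lin).
  apply: (@riesz_representation phiL (M * `|y|)) => x.
  by rewrite (le_trans (cauchy_schwarz _ _))// mulrAC ler_wpM2r//.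
have [f fE] := choice Arep.
have f_lin : linear f.
  move=> a u v; apply: hdot_injr => x.
  by rewrite -fE !linearPr /= !fE.
pose fL : {linear H -> H} :=
  HB.pack f (GRing.isLinear.Build R[i] H H *:%R f f_lin).
have fM x : `|f x| <= M * `|x|.
  have [->|fx0] := eqVneq (f x) 0; first by rewrite normr0 mulr_ge0.
  rewrite -(@ler_pM2r _ `|f x|) ?normr_gt0// -expr2.
  rewrite -[`|f x| ^+ 2]ger0_norm ?exprn_ge0// hdot_norm -fE.
  by rewrite (le_trans (cauchy_schwarz _ _))// mulrAC ler_wpM2r//.
have fB : bounded_near fL (nbhs (0 : H)).
  apply/linear_boundedP; near=> r => x; rewrite (le_trans (fM x))// ler_wpM2r//.
  by near: r; apply: nbhs_pinfty_ge; rewrite ger0_real.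
by exists (Bop fB) => x y; rewrite fE.
Unshelve. all: by end_near. Qed.

Lemma hdot_adjoint (A : bop H) x y : hdot (A x) y = hdot x ((A^*)%Bop y).
Proof.
suff: [set A' : bop H | forall x y, hdot (A x) y = hdot x (A' y)] (A^*)%Bop.
  exact.
exact: xgetPex (adjoint_exists A).
Qed.

Lemma adjoint_unique (A A' : bop H) :
  (forall x y, hdot (A x) y = hdot x (A' y)) -> (A^*)%Bop = A'.
Proof.
move=> AA'; apply/bopP => y; apply: hdot_injr => x.
by rewrite -hdot_adjoint AA'.
Qed.

Lemma adjointK (A : bop H) : (A^* ^*)%Bop = A.
Proof.
by apply: adjoint_unique => x y; rewrite hdotC -hdot_adjoint -hdotC.
Qed.

Lemma adjoint_comp (A B : bop H) : ((A * B)^*)%Bop = (B^* * A^*)%Bop.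
Proof. by apply: adjoint_unique => x y /=; rewrite !hdot_adjoint. Qed.

Lemma bop_compA (A B C : bop H) : (A * (B * C))%Bop = (A * B * C)%Bop.
Proof. exact/bopP. Qed.

End HilbertSpace.

(** * The characterization of the star order *)

Theorem proposition4p2 (R : realType) (H : hilbertType R) (B P Q : bop H)
    (projP : orthogonal_projection P) (projQ : orthogonal_projection Q)
    (ranP : range P `<=` closure (range B))
    (ranQ : range Q `<=` closure (range (adjoint B))) :
  (P * B * Q <=* B)%Bop <->
  (P * B * Q * B^* = B * Q * B^* * P)%Bop /\
  (Q * B^* * P * B = B^* * P * B * Q)%Bop.
Proof.
(* In both directions, associativity brings squares Q * Q and P * P together. *)
have [[PP Pa] [QQ Qa]] := (projP, projQ).
rewrite /star_le !adjoint_comp Pa Qa !bop_compA.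
split=> [[eqL eqR]|[eqL eqR]]; split.
- move: eqL; rewrite -(bop_compA _ Q Q) QQ => eqL; rewrite -eqL.
  have := congr1 (@adjoint R H) eqL.
  by rewrite !adjoint_comp !adjointK Pa Qa !bop_compA => ->.
- move: eqR; rewrite -(bop_compA _ P P) PP => eqR; rewrite -eqR.
  have := congr1 (@adjoint R H) eqR.
  by rewrite !adjoint_comp !adjointK Pa Qa !bop_compA => ->.
- by rewrite -(bop_compA _ Q Q) QQ eqL -bop_compA PP.
- rewrite -(bop_compA _ P P) PP -!bop_compA (bop_compA B^*) (bop_compA _ B).
  by rewrite -eqR !bop_compA QQ.
Qed.
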